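(* Let $Y$ be a Banach space with the Radon-Nikodým property. Then the set of norm attaining operators without the adjusted Bhatia-Šemrl property, i.e. $\mathrm{NA}(L_1[0,1],Y)\setminus\mathrm{BS}_a(L_1[0,1],Y)$, is norm-dense in $\mathcal{L}(L_1[0,1],Y)$.
   Context: All Banach spaces are real. $S_X$ is the unit sphere of $X$, and $\mathcal{L}(X,Y)$ is the space of bounded linear operators from $X$ to $Y$ with the operator norm. For $T\in\mathcal{L}(X,Y)$ put $M_T=\{x\in S_X:\|Tx\|=\|T\|\}$; $T$ attains its norm if $M_T\neq\emptyset$, and $\mathrm{NA}(X,Y)$ is the set of norm attaining operators. $L_1[0,1]$ is taken with respect to Lebesgue measure. For vectors $x,y$ of a Banach space: $x\perp_B y$ means $\|x\|\le\|x+\lambda y\|$ for all $\lambda\in\mathbb{R}$; $x\perp_S y$ means $\|x\|<\|x+\lambda y\|$ for all $\lambda\in\mathbb{R}\setminus\{0\}$. $\mathrm{BS}_a(X,Y)$ (operators with the adjusted Bhatia-Šemrl property) is the set of $T\in\mathrm{NA}(X,Y)$ such that for every $S\in\mathcal{L}(X,Y)$ with $T\perp_S S$ there is $x_0\in M_T$ with $Tx_0\perp_B Sx_0$.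
   Formalization: The Banach space Y is additionally assumed to be nonzero; for Y = {0} the only operator is 0, which attains its norm and has the adjusted Bhatia-Šemrl property vacuously, so the set is empty and not dense. *)

(* Defs.v *)
From HB Require Import structures.
From mathcomp Require Import all_boot all_order all_algebra.
From mathcomp Require Import all_classical all_reals all_analysis.
From mathcomp Require Import measurable_realfun ess_sup_inf.

Set Implicit Arguments.
Unset Strict Implicit.
Unset Printing Implicit Defensive.
Import Order.TTheory GRing.Theory Num.Theory.
Import numFieldNormedType.Exports.

Local Open Scope classical_set_scope.
Local Open Scope ring_scope.

(* The library's [LspaceType mu p1] (classes of measurable functions modulo
   equality mu-a.e., with finite p-norm) comes without algebraic structure;
   below it is made a normed module with the norm ['N[mu]_p]. *)
Section Lspace_normed.
Context d (T : measurableType d) (R : realType).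
Variables (mu : {measure set T -> \bar R}) (p : \bar R) (p1 : (1 <= p)%E).
Local Open Scope quotient_scope.
Local Notation Lf := (LfunType mu p1).
Local Notation Ls := (LspaceType mu p1).
Local Notation Q := {mfun_ mu, T >-> measurableTypeR R}.

HB.instance Definition _ := gen_eqMixin Ls.
HB.instance Definition _ := gen_choiceMixin Ls.

Lemma Lspace_val_inj (F G : Ls) :
  LebesgueSpace.sort F = LebesgueSpace.sort G -> F = G.
Proof.
case: F G => [F [[cF]]] [G [[cG]]] /= FG; move: FG cF cG => -> cF cG.
by rewrite (Prop_irrelevance cF cG).
Qed.

Lemma ae_eq_Lnorm (f g : T -> R) : measurable_fun setT f ->
  measurable_fun setT g -> f = g %[ae mu] ->
  ('N[mu]_p[EFin \o f] = 'N[mu]_p[EFin \o g])%E.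
Proof.
move=> mf mg fg; rewrite unlock /Lnorm; case: p p1 => [r r1|_|//].
- congr (_ `^ _)%E; apply: ge0_ae_eq_integral => //.
  + apply/measurable_EFinP; apply: (@measurableT_comp _ _ _ _ _ _ (@powR R ^~ r)) => //.
    exact: measurableT_comp.
  + apply/measurable_EFinP; apply: (@measurableT_comp _ _ _ _ _ _ (@powR R ^~ r)) => //.
    exact: measurableT_comp.
  + by move=> x _; rewrite lee_fin powR_ge0.
  + by move=> x _; rewrite lee_fin powR_ge0.
  + by move: fg; apply: filterS => x /= /(_ I) ->.
- case: ifPn => // _; apply: eq_ess_sup.
  by move: fg; apply: filterS => x /= /(_ I) ->.
Qed.

Let repr_Lfun (F : Ls) : (F : T -> R) \in Lfun mu p.
Proof.
apply/andP; split; rewrite inE /=.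
  exact: (@measurable_funPT _ _ _ _ (repr (LebesgueSpace.sort F))).
by case: F => [F [[]]].
Qed.

Definition Lspace_repr (F : Ls) : Lf := Lfun_Sub p1 (repr_Lfun F).

Let pi_repr_ae (f : {mfun T >-> measurableTypeR R}) :
  (repr (\pi_Q f) : T -> R) = f %[ae mu].
Proof.
have /eqP := @reprK _ Q (\pi_Q f).
by rewrite eqmodE => /asboolP.
Qed.

Let mfunR (f : Lf) : {mfun T >-> measurableTypeR R} :=
  HB.pack (f : T -> measurableTypeR R)
    (isMeasurableFun.Build _ _ T (measurableTypeR R) f (@measurable_funPT _ _ _ _ f)).

Let pi_finite_norm (f : Lf) : finite_norm mu p (\pi_Q (mfunR f) : Q).
Proof.
rewrite /finite_norm (@ae_eq_Lnorm _ f).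
- exact: Lfunction_finite.
- exact: (@measurable_funPT _ _ _ _ (repr (\pi_Q (mfunR f)))).
- exact: measurable_funPT.
- exact: (pi_repr_ae (mfunR f)).
Qed.

Definition Lspace_of (f : Lf) : Ls :=
  HB.pack (\pi_Q (mfunR f))
    (isFinLebesgue.Build d T R mu p p1 _ (pi_finite_norm f)).

Lemma Lspace_ofK (f : Lf) : (Lspace_repr (Lspace_of f) : T -> R) = f %[ae mu].
Proof. exact: (pi_repr_ae (mfunR f)). Qed.

Lemma Lspace_ae_inj (F G : Ls) :
  (Lspace_repr F : T -> R) = Lspace_repr G %[ae mu] -> F = G.
Proof.
move=> FG; apply: Lspace_val_inj.
rewrite -(reprK (LebesgueSpace.sort F)) -(reprK (LebesgueSpace.sort G)).
by apply/eqP; rewrite eqmodE; apply/asboolP.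
Qed.

Lemma Lspace_ofP (f g : Lf) : Lspace_of f = Lspace_of g <-> (f : T -> R) = g %[ae mu].
Proof.
split=> [fg|fg].
  apply: ae_eq_trans (Lspace_ofK g); rewrite -fg.
  exact/ae_eq_sym/Lspace_ofK.
apply: Lspace_ae_inj; apply: ae_eq_trans (Lspace_ofK f) _.
exact/(ae_eq_trans fg)/ae_eq_sym/Lspace_ofK.
Qed.

Lemma Lspace_reprK : cancel Lspace_repr Lspace_of.
Proof. by move=> F; apply: Lspace_ae_inj; exact: Lspace_ofK. Qed.

Definition Lspace_add (F G : Ls) := Lspace_of (Lspace_repr F + Lspace_repr G).
Definition Lspace_opp (F : Ls) := Lspace_of (- Lspace_repr F).
Definition Lspace_scale (a : R) (F : Ls) := Lspace_of (a *: Lspace_repr F).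
Definition Lspace_norm (F : Ls) : R :=
  fine ('N[mu]_p[EFin \o Lspace_repr F])%E.

Lemma Lspace_ofD f g : Lspace_of (f + g) = Lspace_add (Lspace_of f) (Lspace_of g).
Proof.
apply/esym/Lspace_ofP; have := Lspace_ofK f; have := Lspace_ofK g.
by apply: filterS2 => x /= gx fx _; rewrite /= !fctE fx // gx.
Qed.

Lemma Lspace_ofN f : Lspace_of (- f) = Lspace_opp (Lspace_of f).
Proof.
apply/esym/Lspace_ofP; have := Lspace_ofK f.
by apply: filterS => x /= fx _; rewrite /= !fctE fx.
Qed.

Lemma Lspace_ofZ a f : Lspace_of (a *: f) = Lspace_scale a (Lspace_of f).
Proof.
apply/esym/Lspace_ofP; have := Lspace_ofK f.
by apply: filterS => x /= fx _; rewrite /= !fctE fx.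
Qed.

Let addA : associative Lspace_add.
Proof.
move=> F G H; rewrite -(Lspace_reprK F) -(Lspace_reprK G) -(Lspace_reprK H).
by rewrite -!Lspace_ofD addrA.
Qed.

Let addC : commutative Lspace_add.
Proof. by move=> F G; rewrite /Lspace_add addrC. Qed.

Let add0 : left_id (Lspace_of 0) Lspace_add.
Proof. by move=> F; rewrite -(Lspace_reprK F) -Lspace_ofD add0r. Qed.

Let addN : left_inverse (Lspace_of 0) Lspace_opp Lspace_add.
Proof.
by move=> F; rewrite -(Lspace_reprK F) -Lspace_ofN -Lspace_ofD addNr.
Qed.

HB.instance Definition _ := GRing.isZmodule.Build Ls addA addC add0 addN.

Let scaleA a b F : Lspace_scale a (Lspace_scale b F) = Lspace_scale (a * b) F.
Proof. by rewrite -(Lspace_reprK F) -!Lspace_ofZ scalerA. Qed.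

Let scale1 : left_id 1 Lspace_scale.
Proof. by move=> F; rewrite -(Lspace_reprK F) -Lspace_ofZ scale1r. Qed.

Let scaleDr : right_distributive Lspace_scale +%R.
Proof.
move=> a F G; rewrite -(Lspace_reprK F) -(Lspace_reprK G).
rewrite -[Lspace_of _ + Lspace_of _]Lspace_ofD -!Lspace_ofZ scalerDr.
exact: Lspace_ofD.
Qed.

Let scaleDl F : {morph Lspace_scale^~ F : a b / a + b}.
Proof.
move=> a b; rewrite -(Lspace_reprK F) -!Lspace_ofZ scalerDl.
exact: Lspace_ofD.
Qed.

HB.instance Definition _ :=
  GRing.Zmodule_isLmodule.Build R Ls scaleA scale1 scaleDr scaleDl.

Lemma Lspace_norm_of (f : Lf) :
  Lspace_norm (Lspace_of f) = fine ('N[mu]_p[EFin \o f])%E.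
Proof.
congr fine; apply: ae_eq_Lnorm; last exact: Lspace_ofK.
- exact: (@measurable_funPT _ _ _ _ (Lspace_repr (Lspace_of f))).
- exact: measurable_funPT.
Qed.

Let normD F G : Lspace_norm (F + G) <= Lspace_norm F + Lspace_norm G.
Proof.
rewrite -(Lspace_reprK F) -(Lspace_reprK G) -[_ + _ in leLHS]Lspace_ofD.
by rewrite !Lspace_norm_of; exact: ler_LnormD.
Qed.

Let normZ (a : R) F : Lspace_norm (a *: F) = `|a| * Lspace_norm F.
Proof.
rewrite -(Lspace_reprK F) -[_ *: _]Lspace_ofZ !Lspace_norm_of.
by apply: EFin_inj; rewrite EFinM !finite_norm_fine LnormZ.
Qed.

Let norm_eq0 F : Lspace_norm F = 0 -> F = 0.
Proof.
rewrite -(Lspace_reprK F) Lspace_norm_of => /fine_Lnormr_eq0 F0.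
exact/Lspace_ofP.
Qed.

HB.instance Definition _ :=
  Lmodule_isNormed.Build R Ls normD normZ norm_eq0.

Lemma Lspace_normE (F : Ls) : `|F| = fine ('N[mu]_p[EFin \o (F : T -> R)])%E.
Proof. by []. Qed.

End Lspace_normed.

Section bounded_operators.
Context (R : realType) (X Y : normedModType R).

Definition bounded_linear : {pred X -> Y} := mem
  [set T : X -> Y | linear T /\ exists M : R, forall x, `|T x| <= M * `|x|].

Record blin := BLin { blin_fun :> X -> Y; blin_funP : blin_fun \in bounded_linear }.

HB.instance Definition _ := [isSub for blin_fun].
HB.instance Definition _ := [Choice of blin by <:].

Lemma bounded_linear_submod : submod_closed bounded_linear.
Proof.
have z0 x : (0 : X -> Y) x = 0 by [].
have DZ a S T x : (a *: S + T : X -> Y) x = a *: S x + T x by [].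
split=> [|a S T]; rewrite !inE /=.
  split=> [b x y|]; first by rewrite !z0 scaler0 addr0.
  by exists 0 => x; rewrite z0 normr0 mul0r.
move=> [lS [M SM]] [lT [N TN]]; split=> [b x y|].
  by rewrite !DZ lS lT !scalerDr !scalerA (mulrC a b) addrACA.
exists (`|a| * M + N) => x; rewrite DZ (le_trans (ler_normD _ _))//.
by rewrite mulrDl lerD// normrZ -mulrA ler_wpM2l.
Qed.

HB.instance Definition _ :=
  GRing.isSubmodClosed.Build R (X -> Y) bounded_linear bounded_linear_submod.
HB.instance Definition _ := [SubChoice_isSubLmodule of blin by <:].

Definition op_norm (T : blin) : R :=
  sup [set `|T x| | x in [set x : X | `|x| <= 1]].

Lemma blin_linear (T : blin) : linear T.
Proof. by have := blin_funP T; rewrite inE => -[]. Qed.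

HB.instance Definition _ (T : blin) :=
  GRing.isLinear.Build R X Y *:%R (blin_fun T) (blin_linear T).

Lemma blin_bounded (T : blin) : exists M : R, forall x, `|T x| <= M * `|x|.
Proof. by have := blin_funP T; rewrite inE => -[]. Qed.

Let has_sup_op_norm (T : blin) :
  has_sup [set `|T x| | x in [set x : X | `|x| <= 1]].
Proof.
split; first by exists `|T 0|, 0 => //=; rewrite normr0.
have [M TM] := blin_bounded T; exists `|M| => _ [x /= x1 <-].
by rewrite (le_trans (TM x))// (le_trans (ler_norm _))// normrM normr_id ler_piMr.
Qed.

Lemma op_norm_ub (T : blin) x : `|x| <= 1 -> `|T x| <= op_norm T.
Proof. by move=> x1; apply: ub_le_sup; [case: (has_sup_op_norm T)|exists x]. Qed.

Lemma op_norm_le (T : blin) M :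
  (forall x, `|x| <= 1 -> `|T x| <= M) -> op_norm T <= M.
Proof.
move=> TM; apply: ge_sup; first by case: (has_sup_op_norm T).
by move=> _ [x x1 <-]; exact: TM.
Qed.

Lemma op_normP (T : blin) x : `|T x| <= op_norm T * `|x|.
Proof.
have [->|x0] := eqVneq x 0; first by rewrite linear0 !normr0 mulr0.
rewrite -ler_pdivrMr ?normr_gt0//.
have := @op_norm_ub T (`|x|^-1 *: x).
rewrite linearZ /= !normrZ normfV normr_id mulVf ?normr_eq0// lexx mulrC.
exact.
Qed.

Let op_normD (S T : blin) : op_norm (S + T) <= op_norm S + op_norm T.
Proof.
apply: op_norm_le => x x1; rewrite (le_trans (ler_normD _ _))//.
by apply: lerD; exact: op_norm_ub.
Qed.

Let op_norm_ge0 (T : blin) : 0 <= op_norm T.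
Proof. by rewrite (le_trans _ (@op_norm_ub T 0 _)) ?normr0. Qed.

Let op_normZ (a : R) (T : blin) : op_norm (a *: T) = `|a| * op_norm T.
Proof.
have leZ (b : R) (S : blin) : op_norm (b *: S) <= `|b| * op_norm S.
  apply: op_norm_le => x x1; rewrite normrZ ler_wpM2l//; exact: op_norm_ub.
apply/eqP; rewrite eq_le leZ /=; have [->|a0] := eqVneq a 0.
  by rewrite normr0 mul0r op_norm_ge0.
rewrite -ler_pdivlMl ?normr_gt0// -normfV.
by rewrite (le_trans _ (leZ _ _))// scalerA mulVf// scale1r.
Qed.

Let op_norm_eq0 (T : blin) : op_norm T = 0 -> T = 0.
Proof.
move=> T0; apply/val_inj/funext => x; apply/normr0_eq0/le_anti.
by rewrite normr_ge0 andbT (le_trans (op_normP T x))// T0 mul0r.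
Qed.

HB.instance Definition _ :=
  Lmodule_isNormed.Build R blin op_normD op_normZ op_norm_eq0.

Lemma blin_normE (T : blin) :
  `|T| = sup [set `|T x| | x in [set x : X | `|x| <= 1]].
Proof. by []. Qed.

End bounded_operators.

Section orthogonality.
Context (R : realType) (V : normedModType R).
Implicit Types x y : V.

Definition orthB x y := forall a : R, `|x| <= `|x + a *: y|.

Definition orthS x y := forall a : R, a != 0 -> `|x| < `|x + a *: y|.

End orthogonality.

Section norm_attainment.
Context (R : realType) (X Y : normedModType R).

Definition norm_attaining_set (T : blin X Y) : set X :=
  [set x | `|x| = 1 /\ `|T x| = `|T| ].

Definition NA : set (blin X Y) := [set T | norm_attaining_set T !=set0].

Definition BSa : set (blin X Y) :=
  [set T | NA T /\ forall S : blin X Y, orthS T S ->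
    exists2 x0, norm_attaining_set T x0 & orthB (T x0) (S x0)].

End norm_attainment.
Arguments NA {R} X Y.
Arguments BSa {R} X Y.

Section vector_measures.
Context d (T : measurableType d) (R : realType) (Y : normedModType R).
Variable mu : {finite_measure set T -> \bar R}.

(* Countable additivity; taking [F] constantly empty gives [G set0 = 0]. *)
Definition vector_measure (G : set T -> Y) := forall F : (set T)^nat,
  (forall n, measurable (F n)) -> trivIset setT F ->
  series (G \o F) @ \oo --> G (\bigcup_n F n).

Definition bounded_vvariation (G : set T -> Y) := exists M : R,
  forall n (F : 'I_n -> set T), (forall i, measurable (F i)) ->
    trivIset setT F -> \bigcup_i F i = setT -> \sum_(i < n) `|G (F i)| <= M.

Definition mu_continuous (G : set T -> Y) := forall e : R, 0 < e ->
  exists2 r : R, 0 < r &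
    forall A, measurable A -> (mu A < r%:E)%E -> `|G A| < e.

(* [{sfun T >-> _}] is restricted to real-valued functions. *)
Definition vsimple (s : T -> Y) :=
  finite_set (range s) /\ forall y, measurable (s @^-1` [set y]).

Definition vsimple_integral (s : T -> Y) (A : set T) : Y :=
  \sum_(y \in range s) fine (mu (A `&` s @^-1` [set y])) *: y.

Definition bochner_measurable (g : T -> Y) := exists s : (T -> Y)^nat,
  (forall n, vsimple (s n)) /\ {ae mu, forall x, s n x @[n --> \oo] --> g x}.

Definition bochner_approx (g : T -> Y) (s : (T -> Y)^nat) :=
  (forall n, vsimple (s n)) /\
  (\int[mu]_x (`|g x - s n x|)%:E)%E @[n --> \oo] --> 0%E.

Definition bochner_integrable (g : T -> Y) :=
  bochner_measurable g /\ exists s, bochner_approx g s.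

(* [v] is the Bochner integral of [g] over [A]. *)
Definition is_bochner_integral (g : T -> Y) (A : set T) (v : Y) :=
  exists2 s, bochner_approx g s & vsimple_integral (s n) A @[n --> \oo] --> v.

End vector_measures.

Definition radon_nikodym_property (R : realType) (Y : completeNormedModType R) :=
  forall (d : measure_display) (T : measurableType d)
    (mu : {finite_measure set T -> \bar R}) (G : set T -> Y),
  vector_measure G -> bounded_vvariation G -> mu_continuous mu G ->
  exists2 g : T -> Y, bochner_integrable mu g &
    forall A, measurable A -> is_bochner_integral mu g A (G A).

(* Lebesgue measure on [0, 1], as a measure on R vanishing outside [0, 1]; the
   elements of [L1_01 R] are thus classes of functions modulo equality
   a.e. on [0, 1]. *)
Definition lebesgue01 (R : realType) :
    {measure set (measurableTypeR R) -> \bar R} :=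
  mrestr lebesgue_measure (measurable_itv `[(0 : R), 1]).

Definition L1_01 (R : realType) : normedModType R := LspaceType1 (lebesgue01 R).

(* Main.v *)
From HB Require Import structures.
Require Import Defs.
From mathcomp Require Import all_boot all_order all_algebra finmap.
From mathcomp Require Import all_classical all_reals all_analysis.
From mathcomp Require Import measurable_realfun lra ring.

(* Let K be the norm of U.  By the Radon-Nikodym property, the vector measure
   B |-> U 1_B has a Bochner density, which countably many e-balls cover up to
   a null set; hence on some set A of positive measure U is e-close to
   F |-> (int_A F) y, with |y| close to K.  Let c = K + e, let u be the
   normalisation of y, and let theta : [0, 1] -> [0, 1] vanish on a part A_1 of
   A of positive measure and take arbitrarily small positive values on A.  Put
     V F = U (1_(~A) F) + (int_A (c - e theta^2) F) u,
     S F = (int_A (1_(theta = 0) - theta) F) u.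
   Then V is close to U and has norm c, attained only by functions F supported
   in A_1; for these V F = c S F, so V F is not Birkhoff-James orthogonal to
   S F.  Yet |V + a S| > c for every a != 0: look at A_1 if a > 0, and at
   {0 < theta < -a/e} if a < 0, where c - e theta^2 - a theta > c. *)

Set Implicit Arguments.
Unset Strict Implicit.
Unset Printing Implicit Defensive.
Import Order.TTheory GRing.Theory Num.Theory.
Import numFieldNormedType.Exports HBSimple.
Local Open Scope classical_set_scope.
Local Open Scope ring_scope.

(** * The space L1 of a finite measure: passing between functions and classes, and the integral
    functional *)

Section L1_classes.
Context d (T : measurableType d) (R : realType).
Variable mu : {finite_measure set T -> \bar R}.
Local Notation L1 := (LspaceType1 mu).
Local Notation rep := (@Lspace_repr _ T R mu 1%E (@lexx _ _ 1%E)).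
Local Notation intble f := (mu.-integrable setT (EFin \o f)).
Implicit Types (F G : L1) (f g phi psi : T -> R).

Lemma rep_integrable F : intble (rep F : T -> R).
Proof. by apply/Lfun1_integrable; exact: LfunP. Qed.

(* Junk value 0 when [f] is not integrable. *)
Definition L1_class f : L1 :=
  if pselect (intble f) is left h
  then Lspace_of (Lfun_Sub (@lexx _ _ 1%E) ((Lfun1_integrable mu f).2 h)) else 0.

Lemma rep_L1_class f : intble f -> (rep (L1_class f) : T -> R) = f %[ae mu].
Proof. by rewrite /L1_class => h; case: pselect => // h'; exact: Lspace_ofK. Qed.

Lemma L1_class_rep F : L1_class (rep F) = F.
Proof. by apply: Lspace_ae_inj; exact/rep_L1_class/rep_integrable. Qed.

Lemma eq_L1_class f g : intble f -> intble g -> f = g %[ae mu] ->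
  L1_class f = L1_class g.
Proof.
move=> fi gi fg; apply: Lspace_ae_inj.
apply: ae_eq_trans (rep_L1_class fi) _; apply: ae_eq_trans fg _.
exact/ae_eq_sym/rep_L1_class.
Qed.

Lemma rep_add F G : (rep (F + G) : T -> R) = (rep F \+ rep G)%R %[ae mu].
Proof. exact: (Lspace_ofK (rep F + rep G)). Qed.

Lemma rep_scale a F : (rep (a *: F) : T -> R) = (fun x => a * rep F x) %[ae mu].
Proof. exact: (Lspace_ofK (a *: rep F)). Qed.

Lemma norm_L1E F : `|F| = \int[mu]_x `|rep F x|.
Proof. by rewrite Lspace_normE /Rintegral Lnorm1. Qed.

Lemma ae_eq_Rintegral f g : intble f -> intble g -> f = g %[ae mu] ->
  \int[mu]_x f x = \int[mu]_x g x.
Proof.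
move=> fi gi fg; congr fine; apply: ae_eq_integral => //.
- exact: measurable_int fi.
- exact: measurable_int gi.
- by apply: filterS fg => x /= + /[dup] => /[apply] ->.
Qed.

Lemma integrable_normr f : intble f -> intble (fun x => `|f x|).
Proof. by move=> /Lfun1_integrable fi; exact/Lfun1_integrable/Lfun_norm. Qed.

Lemma norm_L1_class f : intble f -> `|L1_class f| = \int[mu]_x `|f x|.
Proof.
move=> fi; rewrite norm_L1E; apply: ae_eq_Rintegral.
- by apply: integrable_normr; exact: rep_integrable.
- exact: integrable_normr.
- by apply: filterS (rep_L1_class fi) => x /= /[apply] ->.
Qed.

Lemma integrable_addr f g : intble f -> intble g -> intble (fun x => f x + g x).
Proof. by move=> fi gi; exact: (integrableD measurableT fi gi). Qed.

Lemma integrable_scaler a f : intble f -> intble (fun x => a * f x).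
Proof. by move=> fi; exact: (integrableZl measurableT a fi). Qed.

Lemma L1_classD f g : intble f -> intble g ->
  L1_class (fun x => f x + g x) = L1_class f + L1_class g.
Proof.
move=> fi gi; apply: Lspace_ae_inj.
apply: ae_eq_trans (rep_L1_class (integrable_addr fi gi)) _.
apply/ae_eq_sym; apply: ae_eq_trans (rep_add _ _) _.
by apply: filterS2 (rep_L1_class fi) (rep_L1_class gi) => x /= + + _ => -> // ->.
Qed.

Lemma L1_classZ a f : intble f -> L1_class (fun x => a * f x) = a *: L1_class f.
Proof.
move=> fi; apply: Lspace_ae_inj.
apply: ae_eq_trans (rep_L1_class (integrable_scaler a fi)) _.
apply/ae_eq_sym; apply: ae_eq_trans (rep_scale _ _) _.
by apply: filterS (rep_L1_class fi) => x /= + _ => ->.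
Qed.

Lemma integrable0 : intble (fun=> 0).
Proof. exact: finite_measure_integrable_cst. Qed.

Lemma L1_class0 : L1_class (fun=> 0) = 0.
Proof.
apply: (addrI (L1_class (fun=> 0))); have i0 := integrable0.
by rewrite addr0 -L1_classD//; congr L1_class; apply/funext => x; rewrite addr0.
Qed.

Lemma L1_class_eq0 f : intble f -> L1_class f = 0 -> f = cst 0 %[ae mu].
Proof.
move=> fi; rewrite -L1_class0 => /(congr1 (fun F => (rep F : T -> R))) E.
apply: ae_eq_trans (ae_eq_sym (rep_L1_class fi)) _; rewrite E.
exact/rep_L1_class/integrable0.
Qed.

Definition L1_int F : R := \int[mu]_x rep F x.

Lemma L1_int_class f : intble f -> L1_int (L1_class f) = \int[mu]_x f x.
Proof.
move=> fi; apply: ae_eq_Rintegral => //; first exact: rep_integrable.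
exact: rep_L1_class.
Qed.

Lemma L1_int_linear : linear (L1_int : L1 -> R^o).
Proof.
move=> a F G; rewrite -(L1_class_rep F) -(L1_class_rep G).
have iF := rep_integrable F; have iG := rep_integrable G.
have iZ := integrable_scaler a iF.
rewrite -L1_classZ// -L1_classD// !L1_int_class//; last exact: integrable_addr.
by rewrite RintegralD// RintegralZl.
Qed.

HB.instance Definition _ :=
  GRing.isLinear.Build R L1 R^o *:%R L1_int L1_int_linear.

Lemma L1_int_le F : `|L1_int F| <= `|F|.
Proof.
by rewrite norm_L1E; apply: le_normr_Rintegral => //; exact: rep_integrable.
Qed.

(** * Multiplication of L1 by bounded measurable functions *)

Definition bounded_measurable phi :=
  measurable_fun setT phi /\ exists M : R, forall x, `|phi x| <= M.

Lemma integrable_bounded_mul phi f : bounded_measurable phi -> intble f ->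
  intble (fun x => phi x * f x).
Proof.
move=> [mphi [M phiM]] fi.
have := @integrableMr _ _ _ mu _ measurableT phi _ mphi _ fi.
apply; exists M; split; first exact: num_real.
by move=> r Mr x _ /=; rewrite (le_trans (phiM x))// ltW.
Qed.

Lemma bounded_measurable_integrable phi : bounded_measurable phi -> intble phi.
Proof.
move=> bphi; have := @integrable_bounded_mul phi (cst 1) bphi.
rewrite (_ : (fun x => _) = phi); last by apply/funext => x; rewrite mulr1.
by apply; exact: finite_measure_integrable_cst.
Qed.

Lemma bounded_measurable_cst (a : R) : bounded_measurable (cst a).
Proof. by split => //; exists `|a|. Qed.

Lemma bounded_measurable_indic A : measurable A -> bounded_measurable \1_A.
Proof.
move=> mA; split; first exact: measurable_indic.
by exists 1 => x; rewrite indicE; case: (_ \in _); rewrite ?normr1 ?normr0.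
Qed.

Lemma bounded_measurableM phi psi : bounded_measurable phi ->
  bounded_measurable psi -> bounded_measurable (fun x => phi x * psi x).
Proof.
move=> [mf [M fM]] [mg [N gN]]; split; first exact: measurable_funM.
by exists (M * N) => x; rewrite normrM ler_pM.
Qed.

Lemma bounded_measurableD phi psi : bounded_measurable phi ->
  bounded_measurable psi -> bounded_measurable (fun x => phi x + psi x).
Proof.
move=> [mf [M fM]] [mg [N gN]]; split; first exact: measurable_funD.
by exists (M + N) => x; rewrite (le_trans (ler_normD _ _))// lerD.
Qed.

Definition L1_mul phi F : L1 := L1_class (fun x => phi x * rep F x).

Lemma L1_mul_class phi f : bounded_measurable phi -> intble f ->
  L1_mul phi (L1_class f) = L1_class (fun x => phi x * f x).
Proof.
move=> bphi fi; apply: eq_L1_class.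
- exact/integrable_bounded_mul/rep_integrable.
- exact: integrable_bounded_mul.
- by apply: filterS (rep_L1_class fi) => x /= /[apply] ->.
Qed.

Lemma L1_mul_linear phi : bounded_measurable phi -> linear (L1_mul phi).
Proof.
move=> bphi a F G; rewrite -(L1_class_rep F) -(L1_class_rep G).
have iF := rep_integrable F; have iG := rep_integrable G.
have iZ := integrable_scaler a iF.
rewrite -L1_classZ// -L1_classD// !L1_mul_class//; last exact: integrable_addr.
rewrite -L1_classZ -?L1_classD//;
  [|exact/integrable_scaler/integrable_bounded_mul|..];
  try exact: integrable_bounded_mul.
by congr L1_class; apply/funext => x; rewrite mulrDr mulrCA.
Qed.

Lemma L1_mulD phi psi F : bounded_measurable phi -> bounded_measurable psi ->
  L1_mul (fun x => phi x + psi x) F = L1_mul phi F + L1_mul psi F.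
Proof.
move=> bphi bpsi; have iF := rep_integrable F.
rewrite /L1_mul -L1_classD//; try exact: integrable_bounded_mul.
by congr L1_class; apply/funext => x; rewrite mulrDl.
Qed.

Lemma L1_mulZ a phi F : bounded_measurable phi ->
  L1_mul (fun x => a * phi x) F = a *: L1_mul phi F.
Proof.
move=> bphi; have iF := rep_integrable F.
rewrite /L1_mul -L1_classZ//; last exact: integrable_bounded_mul.
by congr L1_class; apply/funext => x; rewrite mulrA.
Qed.

Lemma L1_mul0 F : L1_mul (fun=> 0) F = 0.
Proof.
by rewrite /L1_mul -L1_class0; congr L1_class; apply/funext => x; rewrite mul0r.
Qed.

Lemma L1_mul1 F : L1_mul (fun=> 1) F = F.
Proof.
rewrite /L1_mul -[RHS]L1_class_rep; congr L1_class.
by apply/funext => x; rewrite mul1r.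
Qed.

Lemma norm_L1_mul phi F : bounded_measurable phi ->
  `|L1_mul phi F| = \int[mu]_x (`|phi x| * `|rep F x|).
Proof.
move=> bphi; have iF := rep_integrable F.
rewrite norm_L1_class; last exact: integrable_bounded_mul.
by apply: eq_Rintegral => x _; rewrite normrM.
Qed.

(** For nonnegative multipliers the pointwise triangle inequality is an equality, so nothing is lost
    on integrating. A multiple of the norm of [F] can thus be split exactly among nonnegative
    multipliers whose sum is constant. *)
Lemma norm_L1_mulD phi psi F :
  bounded_measurable phi -> bounded_measurable psi ->
  (forall x, 0 <= phi x) -> (forall x, 0 <= psi x) ->
  `|L1_mul (fun x => phi x + psi x) F| = `|L1_mul phi F| + `|L1_mul psi F|.
Proof.
move=> bphi bpsi phi0 psi0; have iF := integrable_normr (rep_integrable F).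
rewrite !norm_L1_mul//; last exact: bounded_measurableD.
transitivity (\int[mu]_x (phi x * `|rep F x| + psi x * `|rep F x|)).
  by apply: eq_Rintegral => x _; rewrite ger0_norm ?addr_ge0// mulrDl.
rewrite RintegralD//; try exact: integrable_bounded_mul.
by congr (_ + _); apply: eq_Rintegral => x _; rewrite [X in _ = X * _]ger0_norm.
Qed.

Lemma L1_mul_le phi F (M : R) : bounded_measurable phi ->
  (forall x, `|phi x| <= M) -> `|L1_mul phi F| <= M * `|F|.
Proof.
move=> bphi phiM; have iF := integrable_normr (rep_integrable F).
rewrite norm_L1_mul// norm_L1E -RintegralZl//.
apply: le_Rintegral => //; last by move=> x _; rewrite ler_wpM2r.
- apply: integrable_bounded_mul => //.
  case: bphi => mphi _; split; first exact: measurableT_comp.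
  by exists M => x; rewrite normr_id.
- exact: integrable_scaler.
Qed.

(* On the kernel of multiplication by [rho], only the values of a multiplier
   on the zero set of [rho] matter. *)
Lemma eq_L1_mul rho phi psi F : bounded_measurable rho ->
  bounded_measurable phi -> bounded_measurable psi -> L1_mul rho F = 0 ->
  (forall x, rho x = 0 -> phi x = psi x) -> L1_mul phi F = L1_mul psi F.
Proof.
move=> brho bphi bpsi rho0 pp; have iF := rep_integrable F.
have := L1_class_eq0 (integrable_bounded_mul brho iF) rho0 => r0.
apply: eq_L1_class; try exact: integrable_bounded_mul.
apply: filterS r0 => x /= + _ => /(_ I) /eqP.
by rewrite mulf_eq0 => /orP[/eqP/pp ->|/eqP ->]; rewrite ?mulr0.
Qed.

(** * Classes of indicators *)

Definition L1_indic (A : set T) : L1 := L1_class \1_A.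

Lemma integrable_indicr A : measurable A -> intble (\1_A : T -> R).
Proof.
by move=> mA; exact/bounded_measurable_integrable/bounded_measurable_indic.
Qed.

Lemma Rintegral_indicr A : measurable A -> \int[mu]_x \1_A x = fine (mu A).
Proof. by move=> mA; rewrite /Rintegral integral_indic// setIT. Qed.

Lemma norm_L1_indic A : measurable A -> `|L1_indic A| = fine (mu A).
Proof.
move=> mA; rewrite norm_L1_class; last exact: integrable_indicr.
rewrite -Rintegral_indicr//; apply: eq_Rintegral => x _.
by rewrite ger0_norm// indicE.
Qed.

Lemma L1_indicU A B : measurable A -> measurable B -> A `&` B = set0 ->
  L1_indic (A `|` B) = L1_indic A + L1_indic B.
Proof.
move=> mA mB AB; rewrite /L1_indic -L1_classD; try exact: integrable_indicr.
congr L1_class; apply/funext => x; rewrite !indicE in_setU.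
have [xA|xA] := boolP (x \in A); have [xB|xB] := boolP (x \in B);
  rewrite ?addr0 ?add0r//.
have : (A `&` B) x by split; exact/set_mem.
by rewrite AB.
Qed.

Lemma L1_mul_indic A B : measurable A -> measurable B ->
  L1_mul \1_A (L1_indic B) = L1_indic (A `&` B).
Proof.
move=> mA mB; rewrite L1_mul_class;
  [|exact: bounded_measurable_indic|exact: integrable_indicr].
by congr L1_class; rewrite indicI.
Qed.

(** The difference of the two sides is the integral of [psi], which is nonnegative. Were this
    integral zero, [psi] would vanish almost everywhere, whereas it is positive on [B], a set of
    positive measure. *)
Lemma Rintegral_indic_gt phi (c : R) B : bounded_measurable phi ->
  measurable B -> (0 < mu B)%E -> (forall x, B x -> c < phi x) ->
  c * fine (mu B) < \int[mu]_x (phi x * \1_B x).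
Proof.
move=> bphi mB B0 phic; have iB := integrable_indicr mB.
pose psi x := (phi x - c) * \1_B x.
have bpsi : bounded_measurable psi.
  apply: bounded_measurableM; last exact: bounded_measurable_indic.
  by apply: bounded_measurableD => //; exact: bounded_measurable_cst.
have psi0 x : 0 <= psi x.
  rewrite /psi indicE; have [xB|xB] := boolP (x \in B); last by rewrite mulr0.
  by rewrite mulr1 subr_ge0 ltW//; apply: phic; exact/set_mem.
have ipsi := bounded_measurable_integrable bpsi.
have -> : \int[mu]_x (phi x * \1_B x) = \int[mu]_x (psi x + c * \1_B x).
  by apply: eq_Rintegral => x _; rewrite /psi -mulrDl subrK.
rewrite RintegralD// ?RintegralZl// ?Rintegral_indicr//;
  last exact: integrable_scaler.
rewrite ltrDr lt_neqAle Rintegral_ge0 ?andbT//; apply/eqP => E.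
have /(L1_class_eq0 ipsi) : L1_class psi = 0.
  apply/normr0_eq0; rewrite norm_L1_class// E.
  by apply: eq_Rintegral => x _; rewrite ger0_norm.
move=> [N [mN N0 sub]]; move: B0; rewrite lt_neqAle => /andP[/eqP + _]; apply.
apply/esym; apply: (subset_measure0 mB mN _ N0) => x Bx; apply: sub => /= /(_ I).
rewrite /psi indicE mem_set// mulr1 => /eqP; rewrite subr_eq0 => /eqP E'.
by have := phic x Bx; rewrite E' ltxx.
Qed.

End L1_classes.

(** * Continuity and construction of bounded operators *)

Section blin_theory.
Context (R : realType) (X Y : normedModType R).

Lemma blin_continuous (U : blin X Y) : continuous U.
Proof.
apply: bounded_linear_continuous; apply/linear_boundedP.
exists `|U|; split; first exact: num_real.
move=> M UM x; rewrite (le_trans (op_normP U x))// ler_wpM2r// ltW//.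
Qed.

Lemma exists_blin (f : X -> Y) (M : R) : linear f -> (forall x, `|f x| <= M * `|x|) ->
  exists U : blin X Y, forall x, U x = f x.
Proof.
move=> lf fM; have fP : f \in @bounded_linear R X Y.
  by rewrite inE; split => //; exists M.
by exists (BLin fP).
Qed.

End blin_theory.

(** * Operators on L1 studied through their values on indicators *)

Section L1_operators.
Context d (T : measurableType d) (R : realType).
Variable mu : {finite_measure set T -> \bar R}.
Variable Y : normedModType R.
Local Notation L1 := (LspaceType1 mu).
Local Notation rep := (@Lspace_repr _ T R mu 1%E (@lexx _ _ 1%E)).
Local Notation intble f := (mu.-integrable setT (EFin \o f)).
Local Notation ind := (L1_indic mu).
Implicit Type U : blin L1 Y.

Lemma L1_class_sum (I : Type) (s : seq I) (f : I -> T -> R) :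
  (forall i, intble (f i)) ->
  intble (fun x => \sum_(i <- s) f i x) /\
  L1_class mu (fun x => \sum_(i <- s) f i x) = \sum_(i <- s) L1_class mu (f i).
Proof.
move=> fi; elim: s => [|i s [IHi IHs]].
  have -> : (fun x : T => \sum_(i <- [::]) f i x) = (fun=> 0).
    by apply/funext => x; rewrite big_nil.
  by rewrite big_nil L1_class0; split => //; exact: integrable0.
have E : (fun x : T => \sum_(j <- i :: s) f j x) =
         (fun x => f i x + \sum_(j <- s) f j x).
  by apply/funext => x; rewrite big_cons.
rewrite E big_cons -IHs; split; first exact: integrable_addr.
exact: L1_classD.
Qed.

Lemma L1_sfun_dense (F : L1) (e : R) : 0 < e -> exists h : {sfun T >-> R},
  intble (h : T -> R) /\ `|F - L1_class mu h| < e.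
Proof.
move=> e0; have iF := rep_integrable F.
have [h [ih _ hF]] := approximation_sfun_integrable measurableT iF.
have : \int[mu]_x `|rep F x - h n x| @[n --> \oo] --> (0 : R).
  by apply: fine_cvg; exact: hF.
move=> /cvgrPdist_lt/(_ _ e0) [n _ /(_ n (leqnn n))] /=.
rewrite sub0r normrN => hn; exists (h n); split => //.
apply: le_lt_trans hn; rewrite ger0_norm; last by rewrite fine_ge0// integral_ge0.
rewrite -[F in leLHS]L1_class_rep -scaleN1r -L1_classZ// -L1_classD//;
  last exact: integrable_scaler.
rewrite norm_L1_class;
  last by apply: integrable_addr => //; exact: integrable_scaler.
by under eq_Rintegral do rewrite mulN1r.
Qed.

(** A simple function is a combination of indicators of its disjoint level sets, over which the L1
    norm is additive; so the triangle inequality gives the bound for simple functions, and density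
    does the rest. *)
Lemma blin_L1_le U (c : R) :
  (forall B, measurable B -> `|U (ind B)| <= c * fine (mu B)) ->
  forall F, `|U F| <= c * `|F|.
Proof.
move=> Uc.
have simple (h : {sfun T >-> R}) : intble (h : T -> R) ->
    `|U (L1_class mu h)| <= c * `|L1_class mu h|.
  move=> ih; pose s : seq R := finmap.enum_fset (fset_set (range h)).
  pose B y := h @^-1` [set y].
  have mB y : measurable (B y) by exact: measurable_sfunP.
  pose f y x := y * \1_(B y) x : R.
  have fi y : intble (f y) by apply: integrable_scaler; exact: integrable_indicr.
  have nfi y : intble (fun x => `|f y x|) by exact: integrable_normr.
  have hE x : h x = \sum_(y <- s) f y x by rewrite fimfunE fsbig_finite.
  have nhE x : `|h x| = \sum_(y <- s) `|f y x|.
    have hx : h x \in fset_set (range h) by rewrite in_fset_set// inE; exists x.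
    rewrite (bigD1_seq (h x))//= ?finmap.fset_uniq// big1 ?addr0.
      by rewrite /f indicE mem_set// mulr1.
    move=> y yx; rewrite /f indicE memNset ?mulr0 ?normr0//.
    by move=> /= hy; rewrite hy eqxx in yx.
  have -> : L1_class mu h = \sum_(y <- s) L1_class mu (f y).
    rewrite -(L1_class_sum s fi).2; congr L1_class; exact/funext.
  (* Only the left-hand side is to be expanded: this folds the sum on the right back into the class
     of [h], whose norm is computed separately. *)
  have {2}<- : L1_class mu h = \sum_(y <- s) L1_class mu (f y).
    rewrite -(L1_class_sum s fi).2; congr L1_class; exact/funext.
  rewrite norm_L1_class//.
  have -> : \int[mu]_x `|h x| = \sum_(y <- s) (`|y| * fine (mu (B y))).
    rewrite -L1_int_class; last exact: integrable_normr.
    have -> : (fun x => `|h x|) = (fun x => \sum_(y <- s) `|f y x|).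
      exact/funext.
    rewrite (L1_class_sum s nfi).2.
    have -> : L1_int (\sum_(y <- s) L1_class mu (fun x => `|f y x|)) =
        \sum_(y <- s) L1_int (L1_class mu (fun x => `|f y x|))
      by exact: linear_sum.
    apply: eq_bigr => y _.
    rewrite L1_int_class// -Rintegral_indicr// -RintegralZl//;
      last exact: integrable_indicr.
    apply: eq_Rintegral => x _.
    by rewrite /f normrM [X in _ * X]ger0_norm// indicE ler0n.
  rewrite linear_sum (le_trans (ler_norm_sum _ _ _))// mulr_sumr.
  apply: ler_sum => y _; rewrite L1_classZ; last exact: integrable_indicr.
  by rewrite linearZ/= normrZ mulrCA ler_wpM2l// Uc.
move=> F; apply/ler_addgt0Pl => e e0.
(* Replacing [F] by a simple [H] costs at most |U| |F - H| on the left and |c| |F - H| on the right,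
   [c] being of any sign; the summand 1 makes [M] positive. *)
pose M := `|U| + `|c| + 1; have M0 : 0 < M by rewrite ltr_wpDl// addr_ge0.
have [h [ih Fh]] := L1_sfun_dense F (divr_gt0 e0 M0).
set H := L1_class mu h in Fh *; rewrite -[F in leLHS](subrK H) linearD.
rewrite (le_trans (ler_normD _ _))//.
have := simple h ih; rewrite -/H => UH.
have FH : `|H| <= `|F| + `|F - H|.
  by rewrite -{1}[H](subKr F) (le_trans (ler_normB _ _)).
have FH' : `|F| <= `|H| + `|F - H|.
  by rewrite -{1}[F](subrK H) addrC ler_normD.
have cH : c * `|H| <= c * `|F| + `|c| * `|F - H|.
  rewrite -lerBlDl -mulrBr (le_trans (ler_norm _))// normrM ler_wpM2l//.
  by rewrite ler_norml; apply/andP; split; lra.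
have := op_normP U (F - H); rewrite -[op_norm U]/(`|U|) => UFH.
have : M * `|F - H| <= e by rewrite mulrC -ler_pdivlMr// ltW.
rewrite /M !mulrDl mul1r; have := normr_ge0 (F - H); lra.
Qed.

(** The distance to the limit is the measure of the part of the union not yet covered, which tends
    to 0 by continuity from below. *)
Lemma cvg_L1_indic (F : (set T)^nat) : (forall n, measurable (F n)) ->
  ind (\big[setU/set0]_(i < n) F i) @[n --> \oo] --> ind (\bigcup_n F n).
Proof.
move=> mF; pose D n := \big[setU/set0]_(i < n) F i.
have mD n : measurable (D n) by exact: bigsetU_measurable.
have mU : measurable (\bigcup_n F n) by exact: bigcup_measurable.
have DU n : D n `<=` \bigcup_n F n.
  by rewrite /D -bigcup_mkord; apply: bigcup_sub => i _; exact: bigcup_sup.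
have DE : \bigcup_n D n = \bigcup_n F n.
  apply/seteqP; split; first by apply: bigcup_sub => n _; exact: DU.
  by move=> x [n _ Fx]; exists n.+1 => //; rewrite /D big_ord_recr; right.
have mcvg : fine (mu (D n)) @[n --> \oo] --> fine (mu (\bigcup_n F n)).
  apply: fine_cvg; rewrite fineK ?fin_num_measure// -DE.
  apply: nondecreasing_cvg_mu => //; first by rewrite DE.
  by move=> n m nm; apply/subsetPset; exact: subset_bigsetU.
apply/cvgrPdist_lt => e e0; move/cvgrPdist_lt : mcvg => /(_ _ e0).
apply: filterS => n; rewrite -/(D n).
have -> : ind (\bigcup_n F n) = ind (D n) + ind (\bigcup_n F n `\` D n).
  rewrite -L1_indicU ?setDUK//; [exact: measurableD|by rewrite setDIK].
have mUD : measurable (\bigcup_n F n `\` D n) by exact: measurableD.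
rewrite [X in _ -> is_true (`|X| < _)]addrC addKr norm_L1_indic//.
rewrite measureD// ?ltey_eq ?fin_num_measure//.
rewrite setIidr// fineB ?fin_num_measure//; exact: le_lt_trans (ler_norm _).
Qed.

Lemma L1_indic0 : ind set0 = 0.
Proof. by apply/normr0_eq0; rewrite norm_L1_indic// measure0. Qed.

Lemma L1_indic_bigsetU (F : (set T)^nat) n : (forall n, measurable (F n)) ->
  trivIset setT F ->
  ind (\big[setU/set0]_(i < n) F i) = \sum_(i < n) ind (F i).
Proof.
move=> mF tF; elim: n => [|n IH]; first by rewrite !big_ord0 L1_indic0.
rewrite !big_ord_recr/= L1_indicU ?IH//; first exact: bigsetU_measurable.
by apply: (@trivIset_bigsetUI _ xpredT F) (leqnn n) => //; exact: sub_trivIset tF.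
Qed.

(** This lemma and the next two are the three hypotheses under which the Radon-Nikodym property
    yields a density for [fun A => U (ind A)]. *)
Lemma vector_measure_blin U : vector_measure (fun A => U (ind A)).
Proof.
move=> F mF tF.
have /(cvg_comp _ _ (cvg_L1_indic mF)) :=
  @blin_continuous _ _ _ U (ind (\bigcup_n F n)).
apply: cvg_trans; apply: near_eq_cvg; apply: nearW => n /=.
by rewrite L1_indic_bigsetU// linear_sum seriesEord.
Qed.

Lemma bounded_vvariation_blin U : bounded_vvariation (fun A => U (ind A)).
Proof.
exists (`|U| * fine (mu setT)) => n F mF tF FT.
rewrite (@le_trans _ _ (\sum_(i < n) `|U| * fine (mu (F i))))//.
  by apply: ler_sum => i _; rewrite -norm_L1_indic//; exact: op_normP.
rewrite -mulr_sumr ler_wpM2l// -lee_fin -sumEFin fineK ?fin_num_measure//.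
rewrite (eq_bigr (fun i => mu (F i))) => [|i _];
  last by rewrite fineK ?fin_num_measure.
rewrite -measure_bigsetU_ord// le_measure ?inE//.
exact: bigsetU_measurable.
Qed.

Lemma mu_continuous_blin U : mu_continuous mu (fun A => U (ind A)).
Proof.
move=> e e0; have M0 : 0 < `|U| + 1 by rewrite ltr_wpDl.
exists (e / (`|U| + 1)); first exact: divr_gt0.
move=> A mA; rewrite -(fineK (fin_num_measure mu _ mA)) lte_fin ltr_pdivlMr//.
apply: le_lt_trans; rewrite (le_trans (op_normP U _))// norm_L1_indic// mulrC.
by rewrite ler_wpM2l ?fine_ge0// -[op_norm U]/(`|U|) lerDl.
Qed.

(** Once the cover is made disjoint, the bound passes to finite unions because the measure is
    additive and the norm subadditive, then to [D] by continuity of [U]. The sign of [c] is left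
    free, since the lemma is applied to a difference not yet known to be nonnegative. *)
Lemma blin_L1_indic_cover U (c : R) (F : (set T)^nat) D :
  measurable D -> (forall n, measurable (F n)) -> D `<=` \bigcup_n F n ->
  (forall n B, measurable B -> B `<=` F n -> `|U (ind B)| <= c * fine (mu B)) ->
  `|U (ind D)| <= c * fine (mu D).
Proof.
move=> mD mF DF Uc; pose E n := D `&` seqDU F n.
have mE n : measurable (E n).
  apply: measurableI => //; apply: measurableD => //.
  exact: bigsetU_measurable.
have tE : trivIset setT E by exact/trivIset_setIl/trivIset_seqDU.
have EF n : E n `<=` F n by move=> x [_ []].
have <- : \bigcup_n E n = D.
  by rewrite -setI_bigcupr -seqDU_bigcup_eq; exact: setIidl.
have UE n : `|U (ind (\big[setU/set0]_(i < n) E i))| <=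
    c * `|ind (\big[setU/set0]_(i < n) E i)|.
  rewrite norm_L1_indic; last exact: bigsetU_measurable.
  elim: n => [|n IH].
    by rewrite big_ord0 L1_indic0 linear0 measure0 mulr0 normr0.
  rewrite big_ord_recr/=.
  have mS : measurable (\big[setU/set0]_(i < n) E i) by exact: bigsetU_measurable.
  have dS : (\big[setU/set0]_(i < n) E i) `&` E n = set0.
    by apply: (@trivIset_bigsetUI _ xpredT E) (leqnn n) => //; exact: sub_trivIset tE.
  rewrite L1_indicU// measureU// fineD ?fin_num_measure// mulrDr linearD.
  by rewrite (le_trans (ler_normD _ _))// lerD//; exact: Uc (EF n).
have cE := cvg_L1_indic mE.
rewrite -norm_L1_indic; last exact: bigcup_measurable.
have c1 : `|U (ind (\big[setU/set0]_(i < n) E i))| @[n --> \oo] -->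
    `|U (ind (\bigcup_n E n))|.
  exact: cvg_norm (cvg_comp _ _ cE (@blin_continuous _ _ _ U _)).
have c2 : c * `|ind (\big[setU/set0]_(i < n) E i)| @[n --> \oo] -->
    c * `|ind (\bigcup_n E n)| by apply: cvgMr; exact: cvg_norm cE.
by apply: ler_cvg_to c1 c2 _; exact: nearW.
Qed.

End L1_operators.

(* No measurability of [f] is needed: the integral of a nonnegative function is
   a supremum over the simple functions below it. *)
Lemma ge0_integral_subT d (T : measurableType d) (R : realType)
    (mu : {measure set T -> \bar R}) (B : set T) (f : T -> \bar R) :
  (forall x, 0 <= f x)%E ->
  (\int[mu]_(x in B) f x <= \int[mu]_x f x)%E.
Proof.
move=> f0; rewrite integral_mkcond !ge0_integralTE//; last first.
  by move=> x; rewrite erestrict_ge0.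
apply: le_ereal_sup => _ [h hf <-]; exists h => // x.
apply: le_trans (hf x) _; rewrite patchE; case: ifPn => // _; exact: f0.
Qed.

(** * Measurability and distance estimates for vector-valued simple functions and Bochner
    integrals *)

Section Bochner.
Context d (T : measurableType d) (R : realType).
Variable mu : {finite_measure set T -> \bar R}.
Local Notation m A := (fine (mu A)).

(** Any real function [f] will do, because the preimage of a set is a finite union of level sets of
    [s]. The space [Y] is quantified here so that the lemma also applies to a product space. *)
Lemma measurable_vsimple (Y : normedModType R) (s : T -> Y) (f : Y -> R) :
  vsimple s -> measurable_fun setT (f \o s).
Proof.
move=> [fs ms] _ B mB; rewrite setTI.
rewrite [X in measurable X](_ : _ =
    \bigcup_(y in range s `&` f @^-1` B) (s @^-1` [set y])).
  by apply: fin_bigcup_measurable => //; exact: finite_setIl.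
apply/seteqP; split=> [x /= Bx|x [y [_ By] /= sx]]; last by rewrite /= sx.
by exists (s x) => //; split => //; exists x.
Qed.

Variable Y : normedModType R.

(** The pair of two simple functions is simple with values in [Y * Y], and the distance is a
    function of that pair. *)
Lemma measurable_vsimple_dist (s t : T -> Y) : vsimple s -> vsimple t ->
  measurable_fun setT (fun x => `|s x - t x|).
Proof.
move=> [fs ms] [ft mt].
apply: (@measurable_vsimple (Y * Y)%type (fun x => (s x, t x))
  (fun p => `|p.1 - p.2|)); split.
  apply: sub_finite_set (finite_setX fs ft) => _ [x _ <-].
  by split; exists x.
move=> [y z]; rewrite [X in measurable X](_ : _ =
    s @^-1` [set y] `&` t @^-1` [set z]); first exact: measurableI.
by apply/seteqP; split=> x /= [-> ->].
Qed.

Lemma vsimple_cst (y : Y) : vsimple (cst y : T -> Y).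
Proof.
split; first by apply: sub_finite_set (finite_set1 y) => _ [x _ <-].
move=> z; rewrite preimage_cst.
by case: ifP => _; [exact: measurableT|exact: measurable0].
Qed.

(** With no sigma-algebra on [Y], the measurability of [g] is only used through real functions such
    as this one, a pointwise limit of distances between simple functions. *)
Lemma measurable_lim_vsimple_dist (s : (T -> Y)^nat) (g t : T -> Y) (D : set T) :
  (forall n, vsimple (s n)) -> vsimple t ->
  (forall x, D x -> s n x @[n --> \oo] --> g x) ->
  measurable_fun D (fun x => `|g x - t x|).
Proof.
move=> vs vt sg; apply: (@measurable_fun_cvg _ _ _ _ (fun n x => `|s n x - t x|)).
  by move=> n; apply: measurable_funTS; exact: measurable_vsimple_dist.
move=> x Dx; apply: cvg_norm; apply: cvgB; first exact: sg.
exact: cvg_cst.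
Qed.

(** Cutting [B] along the level sets of [s] turns the left side into the norm of a sum over the
    values of [s], and the right side into the sum of the norms. *)
Lemma vsimple_integral_dist (s : T -> Y) (B : set T) (y : Y) : vsimple s ->
  measurable B ->
  (`|vsimple_integral mu s B - m B *: y|%:E <= \int[mu]_(x in B) (`|s x - y|)%:E)%E.
Proof.
move=> vs mB; have [fs ms] := vs.
pose r := fset_set (range s); pose A z := B `&` s @^-1` [set z].
have mA z : measurable (A z) by exact: measurableI.
have tA : trivIset [set` r] A.
  by move=> z z' _ _ [x [[_ /= <-] [_ /= <-]]].
have BE : \big[setU/set0]_(z <- r) A z = B.
  rewrite -bigcup_fset; apply/seteqP; split=> [x [z _ []//]|x Bx].
  by exists (s x) => //=; rewrite in_fset_set// inE; exists x.
have mBE : m B = \sum_(z <- r) m (A z).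
  rewrite -{1}BE measure_fbigsetU// -[RHS]/(fine (\sum_(z <- r) m (A z))%:E).
  rewrite -sumEFin; congr fine; apply: eq_bigr => z _.
  by rewrite fineK ?fin_num_measure.
have ms' : measurable_fun B (fun x => (`|s x - y|)%:E).
  apply/measurable_EFinP; apply: measurable_funTS.
  exact: (@measurable_vsimple_dist s (cst y) vs (vsimple_cst y)).
rewrite -{3}BE ge0_integral_bigsetU//; last by rewrite BE.
rewrite (eq_bigr (fun z => (`|z - y| * m (A z))%:E)); last first.
  move=> z _; rewrite (eq_integral (cst (`|z - y|)%:E)); last first.
    by move=> x; rewrite inE => -[_ /= ->].
  by rewrite integral_cst// EFinM fineK ?fin_num_measure.
rewrite sumEFin lee_fin /vsimple_integral fsbig_finite// mBE scaler_suml.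
rewrite -[X in `|X|]sumrB (le_trans (ler_norm_sum _ _ _))//.
apply: ler_sum => z _; rewrite -scalerBr normrZ mulrC ger0_norm//.
by rewrite fine_ge0.
Qed.

(** The two sequences have different roles: [s] converges pointwise on [B] and provides
    measurability, while the sequence [t] taken from the definition of the integral converges in
    mean and provides the value [v]. The bound comes from |t_n - y| <= |g - t_n| + |g - y|, the
    first term vanishing in the limit after integration. *)
Lemma bochner_integral_dist (g : T -> Y) (B : set T) (s : (T -> Y)^nat)
    (v y : Y) (e : R) :
  (forall n, vsimple (s n)) -> measurable B ->
  (forall x, B x -> s n x @[n --> \oo] --> g x) ->
  is_bochner_integral mu g B v -> (forall x, B x -> `|g x - y| <= e) ->
  `|v - m B *: y| <= e * m B.
Proof.
move=> vs mB sg [t [vt gt0] tv] gy.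
pose L n := (\int[mu]_x (`|g x - t n x|)%:E)%E.
have LE n : (`|vsimple_integral mu (t n) B - m B *: y|%:E <= L n + (e * m B)%:E)%E.
  apply: le_trans (vsimple_integral_dist y (vt n) mB) _.
  have mgt : measurable_fun B (fun x => (`|g x - t n x|)%:E).
    by apply/measurable_EFinP; exact: (measurable_lim_vsimple_dist vs (vt n) sg).
  have e0 x : B x -> (0 <= e%:E)%E.
    by move=> Bx; rewrite lee_fin (le_trans _ (gy x Bx)).
  apply: (@le_trans _ _ (\int[mu]_(x in B) ((`|g x - t n x|)%:E + cst e%:E x))%E).
    apply: ge0_le_integral => //.
    - apply/measurable_EFinP; apply: measurable_funTS.
      exact: (@measurable_vsimple_dist (t n) (cst y) (vt n) (vsimple_cst y)).
    - exact: emeasurable_funD.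
    - move=> x Bx; rewrite -EFinD lee_fin.
      rewrite (_ : t n x - y = - (g x - t n x) + (g x - y)); last first.
        by rewrite opprB addrA subrK.
      by rewrite (le_trans (ler_normD _ _))// normrN lerD2l gy.
  rewrite ge0_integralD//.
  rewrite integral_cst// EFinM fineK ?fin_num_measure// leeD2r//.
  by apply: ge0_integral_subT => x; rewrite lee_fin.
(* Convergence to 0 makes the [L n] finite only from some rank on, so the inequalities are compared
   eventually. *)
have [Lfin Lcvg] := (fine_cvgP _ _).1 gt0.
have c1 : `|vsimple_integral mu (t n) B - m B *: y| @[n --> \oo] --> `|v - m B *: y|.
  by apply: cvg_norm; apply: cvgB => //; exact: cvg_cst.
have c2 : fine (L n) + e * m B @[n --> \oo] --> 0 + e * m B.
  by apply: cvgD => //; exact: cvg_cst.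
rewrite -[leRHS]add0r; apply: ler_cvg_to c1 c2 _.
apply: filterS Lfin => n Ln; rewrite -lee_fin EFinD fineK//.
Qed.

End Bochner.

(** * An almost constant piece of an operator, from the Radon-Nikodym property *)

Section RNP.
Context d (T : measurableType d) (R : realType).
Variable mu : {finite_measure set T -> \bar R}.
Variable Y : completeNormedModType R.
Local Notation m A := (fine (mu A)).
Local Notation ind := (L1_indic mu).

(** By contradiction: the space is covered, up to a null set, by countably many pieces on which the
    density is [e]-close to a constant [y]. If every such piece of positive measure had |y| <= K -
    2e, then |U 1_B| <= (K - e) mu(B) would hold on each of them, hence everywhere, and the norm of
    [U] would be at most K - e. *)
Lemma RNP_almost_constant (U : blin (LspaceType1 mu) Y) (e : R) :
  radon_nikodym_property Y -> (0 < mu setT)%E -> 0 < e ->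
  exists A y, [/\ measurable A, (0 < mu A)%E, `|U| - 2 * e <= `|y| <= `|U| + e &
    forall B, measurable B -> B `<=` A ->
      `|U (ind B) - m B *: y| <= e * m B].
Proof.
move=> rnp mu0 e0; set K := `|U|.
have [g [[s [vs [N [mN N0 sN]]]] _] Gg] := rnp _ _ mu _
  (@vector_measure_blin _ _ _ _ _ U)
  (bounded_vvariation_blin U) (mu_continuous_blin U).
have sg x : (~` N) x -> s n x @[n --> \oo] --> g x.
  by move=> Nx; apply: contrapT => h; apply: Nx; exact: sN.
have UK B : measurable B -> `|U (ind B)| <= K * m B.
  by move=> mB; rewrite -norm_L1_indic//; exact: op_normP.
have Unull B (c : R) : measurable B -> mu B = 0%E -> `|U (ind B)| <= c * m B.
  by move=> mB B0; rewrite (le_trans (UK _ mB))// B0 !mulr0.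
apply: contrapT => nogood.
suff bound D : measurable D -> `|U (ind D)| <= (K - e) * m D.
  (* Testing the bound on the whole space, of positive measure, fixes the sign of K - e; this is
     what allows the factor |F| <= 1 to be dropped below. *)
  have Ke0 : 0 <= K - e.
    have := le_trans (normr_ge0 _) (bound _ measurableT).
    rewrite pmulr_lge0// fine_gt0// mu0 ltey_eq ?fin_num_measure//.
  suff : K <= K - e by rewrite lerDl oppr_ge0 leNgt e0.
  apply: op_norm_le => F F1; rewrite (le_trans (blin_L1_le bound F))//.
  exact: ler_piMr.
move=> mD.
(* Index 0 is reserved for the exceptional null set; index k + 1 collects the points where [s k] is
   already [e]-close to [g]. *)
pose F k := if k is k'.+1 then ~` N `&` [set x | `|g x - s k' x| <= e] else N.
have mF k : measurable (F k).
  case: k => [//|k] /=.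
  have mNc : measurable (~` N) by exact: measurableC.
  have := measurable_lim_vsimple_dist vs (vs k) sg.
  move=> /(_ mNc `]-oo, e]%classic (measurable_itv _)).
  by congr measurable; apply/seteqP; split=> x /= [? ?]; split => //;
    move: H0; rewrite /= in_itv.
have DF : D `<=` \bigcup_k F k.
  move=> x _; have [Nx|Nx] := pselect (N x); first by exists 0%N.
  have /cvgrPdist_le/(_ _ e0)[k _ /(_ k (leqnn k)) gs] := sg x Nx.
  by exists k.+1.
apply: (blin_L1_indic_cover mD mF DF) => -[|k] C mC CF.
  exact/Unull/(subset_measure0 mC mN CF N0).
(* A second cover, by the values of [s k]. Past the end of [l] the default 0 merely repeats the
   level set of 0, to which the argument applies as well. *)
pose l : seq Y := finmap.enum_fset (fset_set (range (s k))).
pose H j := F k.+1 `&` s k @^-1` [set nth 0 l j].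
have mH j : measurable (H j) by apply: measurableI => //; exact: (vs k).2.
have CH : C `<=` \bigcup_j H j.
  move=> x Cx; exists (index (s k x) l) => //; split; first exact: CF.
  rewrite /= nth_index//.
  have : s k x \in fset_set (range (s k)).
    by rewrite in_fset_set ?inE; [exists x|exact: (vs k).1].
  exact.
apply: (blin_L1_indic_cover mC mH CH) => j B mB BH.
set y := nth 0 l j in BH *.
have [B0|B0] := eqVneq (mu B) 0%E; first exact: Unull.
have Bgt0 : (0 < mu B)%E by rewrite lt0e B0 measure_ge0.
have mB0 : 0 < m B by rewrite fine_gt0// Bgt0 ltey_eq ?fin_num_measure.
have close B' : measurable B' -> B' `<=` B ->
    `|U (ind B') - m B' *: y| <= e * m B'.
  move=> mB' B'B; have B'H x : B' x -> H j x by move=> /B'B /BH.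
  apply: (bochner_integral_dist vs mB' _ (Gg _ mB')).
  - by move=> x /B'H [[Nx _] _]; exact: sg.
  - by move=> x /B'H [[_ /= gs] /= sy]; rewrite /y -sy.
have cB := close B mB (@subset_refl _ B).
have yE : `|m B *: y| = `|y| * m B by rewrite normrZ mulrC ger0_norm// ltW.
have yU : `|y| * m B <= (K + e) * m B.
  rewrite -yE -[m B *: y](subKr (U (ind B))) (le_trans (ler_normB _ _))//.
  by rewrite mulrDl lerD// UK.
have Uy : `|U (ind B)| <= (`|y| + e) * m B.
  rewrite -[U (ind B)](subrK (m B *: y)) (le_trans (ler_normD _ _))// yE.
  by rewrite mulrDl addrC lerD2l.
(* Either |y| + e <= K - e, which is the bound sought, or |y| > K - 2e and the pair [B], [y] is one
   that [nogood] excludes. *)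
rewrite (le_trans Uy)// ler_pM2r// leNgt; apply/negP => ylarge.
apply: nogood; exists B, y; split => //.
rewrite ler_pM2r// in yU; rewrite yU andbT ltW//.
by move: ylarge; lra.
Qed.

End RNP.

(** * The perturbed operator and its failure of the adjusted property *)

Section perturbation.
Context d (T : measurableType d) (R : realType).
Variable mu : {finite_measure set T -> \bar R}.
Variable Y : normedModType R.
Local Notation L1 := (LspaceType1 mu).
Local Notation m A := (fine (mu A)).
Local Notation ind := (L1_indic mu).
Local Notation mul := (@L1_mul _ T R mu).
Local Notation bm := (@bounded_measurable _ T R).

Lemma L1_int_mulD (phi psi : T -> R) (F : L1) : bm phi -> bm psi ->
  L1_int (mul (fun x => phi x + psi x) F) =
  L1_int (mul phi F) + L1_int (mul psi F).
Proof. by move=> bphi bpsi; rewrite L1_mulD// linearD. Qed.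

Lemma L1_int_mulZ (a : R) (phi : T -> R) (F : L1) : bm phi ->
  L1_int (mul (fun x => a * phi x) F) = a * L1_int (mul phi F).
Proof. by move=> bphi; rewrite L1_mulZ// linearZ. Qed.

Lemma L1_mul_indicE (phi : T -> R) B : bm phi -> measurable B ->
  mul phi (ind B) = L1_class mu (fun x => phi x * \1_B x).
Proof. by move=> bphi mB; rewrite L1_mul_class//; exact: integrable_indicr. Qed.

Lemma L1_int_mul_indic (phi : T -> R) B : bm phi -> measurable B ->
  L1_int (mul phi (ind B)) = \int[mu]_x (phi x * \1_B x).
Proof.
move=> bphi mB; rewrite L1_mul_indicE// L1_int_class//.
by apply: integrable_bounded_mul => //; exact: integrable_indicr.
Qed.

Lemma L1_int_mulC_indic (a : R) B : measurable B ->
  L1_int (mul (fun=> a) (ind B)) = a * m B.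
Proof.
move=> mB; rewrite L1_int_mul_indic//; last exact: bounded_measurable_cst.
by rewrite RintegralZl//; [rewrite Rintegral_indicr|exact: integrable_indicr].
Qed.

Lemma L1_int_mul_linear (phi : T -> R) (z : Y) : bm phi ->
  linear (fun F : L1 => L1_int (mul phi F) *: z).
Proof.
move=> bphi a F G; rewrite L1_mul_linear// linearD linearZ/= scalerDl.
by rewrite scalerA.
Qed.

(** The mechanism is the slack multiplier [rho], zero exactly on [A] intersected with the zero set
    of [theta]: the estimate |V F| + |rho F| <= c |F| bounds the norm of [V] and at the same time
    forces rho F = 0 wherever the norm is attained. *)
Lemma exists_NA_not_BSa (U : blin L1 Y) (A : set T) (u y : Y) (e : R)
    (theta : T -> R) :
  0 < e -> measurable A -> `|u| = 1 -> `|(`|U| + e) *: u - y| <= 3 * e ->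
  (forall B, measurable B -> B `<=` A -> `|U (ind B) - m B *: y| <= e * m B) ->
  measurable_fun setT theta -> (forall x, 0 <= theta x <= 1) ->
  (0 < mu (A `&` [set x | theta x = 0%R]))%E ->
  (forall r : R, 0 < r -> (0 < mu (A `&` [set x | (0 < theta x < r)%R]))%E) ->
  exists2 V : blin L1 Y, (NA L1 Y `\` BSa L1 Y) V & `|U - V| <= 5 * e.
Proof.
move=> e0 mA u1 uy UA mtheta theta01 mZ0 mr0; set K := `|U| in uy *.
have K0 : 0 <= K by exact: normr_ge0.
pose c := K + e; have c0 : 0 < c by rewrite /c; lra.
pose Z := [set x | theta x = 0].
have mZ : measurable Z by rewrite -[Z]setTI; exact: (mtheta measurableT [set 0]).
have mAZ : measurable (A `&` Z) by exact: measurableI.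
have bA : bm \1_A by exact: bounded_measurable_indic.
have bZ : bm \1_Z by exact: bounded_measurable_indic.
have bcst (a : R) : bm (fun=> a) by exact: bounded_measurable_cst.
have btheta : bm theta.
  by split => //; exists 1 => x; have /andP[t0 t1] := theta01 x; rewrite ger0_norm.
pose q x := theta x * theta x.
have bq : bm q by exact: bounded_measurableM.
have q01 x : 0 <= q x <= 1.
  have /andP[t0 t1] := theta01 x.
  by rewrite mulr_ge0//= mulr_ile1.
(* The indicator of the complement of [A], written as a polynomial in the indicator of [A] so that
   the closure lemmas and [ring] apply; [w0] and [v0] follow the same pattern. *)
pose oA x : R := 1 + -1 * \1_A x.
have boA : bm oA.
  exact: bounded_measurableD (bcst 1) (bounded_measurableM (bcst (-1)) bA).
pose w0 x := c + - e * q x.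
have bw0 : bm w0.
  exact: bounded_measurableD (bcst c) (bounded_measurableM (bcst (- e)) bq).
pose w x : R := \1_A x * w0 x.
have bw : bm w by exact: bounded_measurableM.
pose v0 x : R := \1_Z x + -1 * theta x.
have bv0 : bm v0.
  exact: bounded_measurableD bZ (bounded_measurableM (bcst (-1)) btheta).
pose v x : R := \1_A x * v0 x.
have bv : bm v by exact: bounded_measurableM.
(* Chosen so that K oA + w + rho is the constant c. All three terms are nonnegative, so their norms
   against any [F] add up exactly to c |F|. *)
pose rho x : R := e * oA x + e * (\1_A x * q x).
have brho : bm rho.
  apply: bounded_measurableD (bounded_measurableM (bcst e) boA) _.
  exact: bounded_measurableM (bcst e) (bounded_measurableM bA bq).
have indA x : x \in A -> \1_A x = 1 :> R by move=> xA; rewrite indicE xA.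
have indNA x : x \notin A -> \1_A x = 0 :> R.
  by move=> /negPf xA; rewrite indicE xA.
have oA0 x : 0 <= oA x.
  by rewrite /oA; have [/indA ->|/indNA ->] := boolP (x \in A); lra.
have eq0 x : 0 <= e * q x <= e.
  have /andP[q0 q1] := q01 x; rewrite mulr_ge0 ?(ltW e0)//=.
  by rewrite ler_piMr// ltW.
have w_ge0 x : 0 <= w x.
  apply: mulr_ge0; first by rewrite indicE ler0n.
  by have := eq0 x; rewrite /w0 /c mulNr; lra.
have rho0 x : 0 <= rho x.
  apply: addr_ge0; first by rewrite mulr_ge0// ltW.
  rewrite mulrCA mulr_ge0 ?indicE ?ler0n//.
  by have /andP[] := eq0 x.
have normE F : K * `|mul oA F| + `|mul w F| + `|mul rho F| = c * `|F|.
  rewrite -[K in LHS]ger0_norm// -normrZ -L1_mulZ//.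
  have bK : bm (fun x => K * oA x) by exact: bounded_measurableM.
  have KoA0 x : 0 <= K * oA x by exact: mulr_ge0.
  rewrite -!norm_L1_mulD//; last 2 first.
  - exact: bounded_measurableD.
  - by move=> x; exact: addr_ge0.
  rewrite (_ : (fun x => _) = fun=> c * 1).
    by rewrite L1_mulZ// L1_mul1 normrZ ger0_norm// ltW.
  by apply/funext => x; rewrite /w /w0 /rho /oA /c; ring.
pose fV F := U (mul oA F) + L1_int (mul w F) *: u.
have fVle F : `|fV F| + `|mul rho F| <= c * `|F|.
  rewrite -normE lerD2r (le_trans (ler_normD _ _))// lerD//; first exact: op_normP.
  by rewrite normrZ u1 mulr1; exact: L1_int_le.
have [V VE] : exists V : blin L1 Y, forall F, V F = fV F.
  apply: (@exists_blin _ _ _ _ c) => [a F G|F].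
    rewrite /fV (L1_mul_linear boA) linearD linearZ (L1_int_mul_linear _ bw)/=.
    by rewrite scalerDr addrACA.
  by rewrite (le_trans _ (fVle F))// lerDl.
have [S SE] : exists S : blin L1 Y, forall F, S F = L1_int (mul v F) *: u.
  have [_ [M vM]] := bv; apply: (@exists_blin _ _ _ _ M) => [|F].
    exact: L1_int_mul_linear.
  rewrite normrZ u1 mulr1 (le_trans (L1_int_le _))//.
  exact: L1_mul_le.
have oAB B : measurable B -> B `<=` A -> mul oA (ind B) = 0.
  move=> mB BA; rewrite L1_mul_indicE// -(L1_class0 mu); congr L1_class.
  apply/funext => x; rewrite indicE.
  have [xB|] := boolP (x \in B); last by rewrite mulr0.
  by rewrite /oA indA ?inE; [lra|exact/BA/set_mem].
have VB B : measurable B -> B `<=` A -> V (ind B) = L1_int (mul w (ind B)) *: u.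
  by move=> mB BA; rewrite VE /fV oAB// linear0 add0r.
have Vc : `|V| <= c.
  apply: op_norm_le => F F1; rewrite VE (le_trans _ (ler_piMr (ltW c0) F1))//.
  by rewrite (le_trans _ (fVle F))// lerDl.
(* On functions supported in [A] the operator V + a S is integration against w + a v, times [u]; the
   indicator of [B] is the test function. *)
have strict (a : R) B : measurable B -> B `<=` A -> (0 < mu B)%E ->
    (forall x, B x -> c < w x + a * v x) -> c < `|V + a *: S|.
  move=> mB BA B0 wv; have mB0 : 0 < m B.
    by rewrite fine_gt0// B0 ltey_eq ?fin_num_measure.
  have bav : bm (fun x => a * v x) by exact: bounded_measurableM.
  have bwv : bm (fun x => w x + a * v x) by exact: bounded_measurableD.
  have := Rintegral_indic_gt bwv mB B0 wv.
  rewrite -L1_int_mul_indic// L1_int_mulD// L1_int_mulZ// => lt_int.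
  rewrite -(ltr_pM2r mB0); apply: lt_le_trans lt_int _.
  rewrite -norm_L1_indic// (le_trans _ (op_normP _ _))//.
  have -> : (V + a *: S) (ind B) = V (ind B) + a *: S (ind B) by [].
  by rewrite VB// SE scalerA -scalerDl normrZ u1 mulr1 ler_norm.
have AZA : A `&` Z `<=` A by move=> x [].
have AZw x : (A `&` Z) x -> w x = c.
  by move=> [Ax Zx]; rewrite /w /w0 /q indA ?inE// Zx; ring.
have AZv x : (A `&` Z) x -> v x = 1.
  move=> [Ax Zx]; rewrite /v /v0 indA ?inE// indicE mem_set//= Zx; ring.
have mAZ0 : 0 < m (A `&` Z).
  by rewrite fine_gt0// mZ0 ltey_eq ?fin_num_measure.
(* The normalised indicator of the zero set of [theta] in [A], where w = c: the norm of [V] is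
   attained there. *)
pose F0 := (m (A `&` Z))^-1 *: ind (A `&` Z).
have F01 : `|F0| = 1.
  by rewrite normrZ norm_L1_indic// gtr0_norm ?invr_gt0// mulVf// gt_eqF.
have VF0 : V F0 = c *: u.
  rewrite linearZ/= VB// scalerA; congr (_ *: _).
  have -> : mul w (ind (A `&` Z)) = mul (fun=> c) (ind (A `&` Z)).
    rewrite !L1_mul_indicE//; congr L1_class; apply/funext => x.
    rewrite indicE; have [|] := boolP (x \in A `&` Z); last by rewrite !mulr0.
    by rewrite inE => /AZw ->.
  by rewrite L1_int_mulC_indic// mulrCA mulVf ?mulr1// gt_eqF.
have VcE : `|V| = c.
  apply/eqP; rewrite eq_le Vc /=.
  have := op_normP V F0; rewrite F01 mulr1 VF0 normrZ u1 mulr1 gtr0_norm//.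
have VNA : NA L1 Y V.
  by exists F0; split => //; rewrite VF0 normrZ u1 mulr1 gtr0_norm.
exists V; last first.
  apply: op_norm_le => F F1.
  apply: (@le_trans _ _ (5 * e * `|F|)); last by rewrite ler_piMr//; lra.
  apply: blin_L1_le => B mB; have mAB : measurable (A `&` B) by exact: measurableI.
  have mAB0 : 0 <= m (A `&` B) by rewrite fine_ge0.
  have ABB : m (A `&` B) <= m B.
    by rewrite fine_le ?fin_num_measure// le_measure ?inE//; exact: subIsetr.
  have -> : (U - V) (ind B) = U (ind B) - V (ind B) by [].
  have oAind : mul oA (ind B) = ind B - ind (A `&` B).
    rewrite L1_mulD//; last exact: bounded_measurableM.
    by rewrite L1_mulZ// L1_mul1 L1_mul_indic// scaleN1r.
  have wind : L1_int (mul w (ind B)) =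
      c * m (A `&` B) + L1_int (mul (fun x => - e * q x) (ind (A `&` B))).
    rewrite -(L1_int_mulC_indic c mAB).
    rewrite -(L1_int_mulD _ (bcst c) (bounded_measurableM (bcst (- e)) bq)).
    congr L1_int; rewrite !L1_mul_indicE//; congr L1_class; apply/funext => x.
    by rewrite indicI /w /w0 /=; ring.
  have rle : `|L1_int (mul (fun x => - e * q x) (ind (A `&` B)))| <= e * m (A `&` B).
    rewrite (le_trans (L1_int_le _))// -norm_L1_indic//; apply: L1_mul_le.
      exact: bounded_measurableM.
    by move=> x; rewrite mulNr normrN ger0_norm; have /andP[] := eq0 x.
  rewrite VE /fV oAind linearB wind; set r := L1_int _ in rle *.
  have UAB := UA _ mAB (@subIsetl _ A B).
  set M := m (A `&` B) in mAB0 ABB UAB rle *.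
  (* Outside [A] the operators agree. Inside, the error 5e is made of e from replacing [U] by [y],
     3e from replacing [y] by c u, and e from the term in e theta^2. *)
  have -> : U (ind B) - (U (ind B) - U (ind (A `&` B)) + (c * M + r) *: u) =
      (U (ind (A `&` B)) - M *: y) - (M *: (c *: u - y) + r *: u).
    rewrite scalerDl scalerBr scalerA [M * c]mulrC opprD addrA subKr.
    by rewrite [X in _ = _ - X]addrAC opprB addrA subrK.
  rewrite (le_trans (ler_normB _ _))//.
  have : `|M *: (c *: u - y) + r *: u| <= M * (3 * e) + e * M.
    rewrite (le_trans (ler_normD _ _))// lerD//; last by rewrite normrZ u1 mulr1.
    by rewrite normrZ ger0_norm// ler_wpM2l.
  move: UAB; have : e * M <= e * m B by rewrite ler_pM2l.
  by set p := e * M; rewrite (mulrCA M 3 e) (mulrC M e) -/p; lra.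
split => // -[_ VBS]; have [|F [F1 VF] ort] := VBS S.
  move=> a a0; rewrite VcE; have [agt0|ale0] := ltP 0 a.
    apply: (strict a (A `&` Z)) => // x AZx; rewrite AZw// AZv//; lra.
  have a_lt0 : a < 0 by rewrite lt_neqAle a0.
  pose B := A `&` [set x | 0 < theta x < - a / e].
  have mB : measurable B.
    apply: measurableI => //.
    rewrite (_ : [set x | _] = setT `&` theta @^-1` `]0, - a / e[%classic).
      exact: mtheta.
    by rewrite setTI; apply/seteqP; split=> x /=; rewrite in_itv.
  apply: (strict a B) => //; first by move=> x [].
    by apply: mr0; rewrite divr_gt0// oppr_gt0.
  move=> x [Ax /andP[t0 ta]]; rewrite /w /v /w0 /v0 /q indA ?inE// !mul1r.
  rewrite indicE memNset ?add0r; last by move=> Zx; rewrite Zx ltxx in t0.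
  rewrite -addrA ltrDl.
  have -> : - e * (theta x * theta x) + a * (-1 * theta x) =
    theta x * (- a - theta x * e) by ring.
  by rewrite mulr_gt0// subr_gt0 -ltr_pdivlMr.
(* Attaining the norm leaves no room for the slack in [fVle]. *)
have rhoF : mul rho F = 0.
  apply/normr0_eq0/le_anti; rewrite normr_ge0 andbT.
  by have := fVle F; rewrite -VE VF VcE F1 mulr1 gerDl.
have inA x : rho x = 0 -> x \in A.
  move=> rx; apply/negPn/negP => /indNA xA; move: rx.
  by rewrite /rho /oA xA => /eqP; rewrite mulr0 mul0r mulr0 !addr0 mulr1 gt_eqF.
(* Since rho F = 0, only the values of the multipliers on the zero set of [rho] count, and there oA
   = 0, w = c and v = 1. *)
have VS : V F = c *: S F.
  rewrite VE SE /fV.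
  have -> : mul oA F = mul (fun=> 0) F.
    by apply: (eq_L1_mul brho) => // x /inA xA; rewrite /oA indA//; lra.
  have -> : mul w F = mul (fun x => c * v x) F.
    apply: (eq_L1_mul brho) => //; first exact: bounded_measurableM.
    move=> x rx; have xA := inA x rx; have xAZ : (A `&` Z) x.
      split; first exact/set_mem.
      move: rx; rewrite /rho /oA indA// mulr1 mul1r subrr mulr0 add0r => /eqP.
      by rewrite mulf_eq0 gt_eqF//= mulf_eq0 orbb => /eqP.
    by rewrite AZw// AZv// mulr1.
  by rewrite L1_mul0 linear0 add0r L1_int_mulZ// scalerA.
(* With the scalar -c the combination V F - c S F is zero, although V F has norm c > 0. *)
have := ort (- c); rewrite VF VcE VS scaleNr subrr normr0.
by rewrite leNgt c0.
Qed.

End perturbation.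

(** * Lebesgue measure on the unit interval: finiteness, halving of sets, and the function
    [theta] *)

Section lebesgue01.
Context (R : realType).
Local Notation TR := (measurableTypeR R).

Lemma lebesgue01_fin_num : fin_num_fun (lebesgue01 R).
Proof.
move=> A mA; rewrite ge0_fin_numE//.
apply: (@le_lt_trans _ _ (lebesgue_measure `[0 : R, 1])).
  rewrite /lebesgue01/= /mrestr le_measure ?inE//; first exact: measurableI.
by rewrite lebesgue_measure_itv/= lte_fin ltr01 oppr0 adde0 ltry.
Qed.

(* [lebesgue01] is declared only as a measure, while the Radon-Nikodym property
   quantifies over [finite_measure] structures. *)
Definition finite_lebesgue01 : set TR -> \bar R := lebesgue01 R.

HB.instance Definition _ := Measure.copy finite_lebesgue01 (lebesgue01 R).

HB.instance Definition _ :=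
  Measure_isFinite.Build _ TR R finite_lebesgue01 lebesgue01_fin_num.

Local Notation mu := (finite_lebesgue01 : {finite_measure set TR -> \bar R}).
Local Notation m A := (fine (mu A)).

Lemma finite_lebesgue01E A : mu A = lebesgue_measure (A `&` `[0, 1]).
Proof. by []. Qed.

(** This makes the distribution function of the measure restricted to [A] 1-Lipschitz, so that it
    takes the value one half of its total exactly. *)
Lemma lebesgue01_itv_le (A : set TR) (x y : R) : measurable A -> x <= y ->
  m (A `&` `]x, y]) <= y - x.
Proof.
move=> mA xy; rewrite -lee_fin fineK ?fin_num_measure//; last exact: measurableI.
have -> : ((y - x)%:E = lebesgue_measure `]x, y])%E.
  rewrite lebesgue_measure_itv/= lte_fin; case: ltP => // yx.
  by rewrite (@le_anti _ _ x y) ?xy// subrr.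
rewrite finite_lebesgue01E le_measure ?inE//.
  by apply: measurableI => //; exact: measurableI.
by move=> z [[]].
Qed.

(* [t] is a median of [A]. *)
Lemma lebesgue01_split (A : set TR) : measurable A -> (0 < mu A)%E ->
  exists t : R, (0 < mu (A `&` `]-oo, t]))%E /\
    forall r : R, 0 < r -> (0 < mu (A `&` `]t, (t + r)%R]))%E.
Proof.
move=> mA A0; pose F (x : R) := m (A `&` `]-oo, x]).
have mI x : measurable (A `&` `]-oo, x] : set TR) by exact: measurableI.
have mJ x y : measurable (A `&` `]x, y] : set TR) by exact: measurableI.
have FD x y : x <= y -> F y = F x + m (A `&` `]x, y]).
  move=> xy; rewrite /F -fineD ?fin_num_measure// -measureU//.
    congr (fine (mu _)); rewrite -setIUr; congr (_ `&` _).
    apply/seteqP; split=> z /=; rewrite !in_itv/=.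
      by case: (leP z x) => /= zx; [left|move=> ->; right].
    by case=> [zx|/andP[]//]; exact: le_trans zx xy.
  apply/seteqP; split=> z //= [[_ +] [_ +]].
  by rewrite /= !in_itv/= => zx /andP[+ _]; rewrite ltNge zx.
have FL x y : x <= y -> F y <= F x + (y - x).
  by move=> xy; rewrite (FD x y xy) lerD2l lebesgue01_itv_le.
pose M := m A; have M0 : 0 < M by rewrite fine_gt0// A0 ltey_eq ?fin_num_measure.
clear A0.
(* At -1 the intersection with the unit interval is literally empty, whereas at 0 a point could
   remain. *)
have FN1 : F (-1) = 0.
  rewrite /F finite_lebesgue01E (_ : _ `&` _ = set0) ?measure0//.
  apply/seteqP; split=> z //= [[_ +] +]; rewrite /= !in_itv/=; lra.
have F1 x : 1 <= x -> F x = M.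
  move=> x1; rewrite /F /M !finite_lebesgue01E; congr (fine (lebesgue_measure _)).
  rewrite -setIA; congr (_ `&` _); apply/seteqP; split=> z /=; first by case.
  by rewrite !in_itv/= => /andP[? ?]; split; lra.
(* Taking the supremum of this set selects the largest median: beyond it [F] exceeds M / 2 at once,
   which is the positive mass required immediately to its right. *)
pose E := [set x : R | F x <= M / 2].
have E1 : ubound E 1.
  move=> x; rewrite /E /= => Fx; rewrite leNgt; apply/negP => x1.
  by move: Fx; rewrite (F1 x (ltW x1)) => Fx; lra.
have hE : has_sup E.
  by split; [exists (-1); rewrite /E /= FN1; lra|exists 1].
pose t := sup E; exists t.
have Ft_gt x : t < x -> M / 2 < F x.
  move=> tx; rewrite ltNge; apply/negP => Ex.
  by have := ub_le_sup hE.2 Ex; rewrite leNgt tx.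
have Ft : F t = M / 2.
  apply/eqP; rewrite eq_le; apply/andP; split; apply/ler_addgt0Pl => r r0.
    have [x Ex xt] := sup_adherent r0 hE.
    have xt' : x <= t by exact: ub_le_sup hE.2 _ Ex.
    by have := FL _ _ xt'; move: Ex xt; rewrite /E /= -/t; lra.
  have := Ft_gt (t + r); have := FL t (t + r).
  by rewrite ltrDl lerDl r0 ltW// => /(_ isT) + /(_ isT); lra.
split.
  by rewrite -(fineK (fin_num_measure mu _ (mI t))) lte_fin -/(F t) Ft; lra.
move=> r r0; rewrite -(fineK (fin_num_measure mu _ (mJ t _))) lte_fin.
have := Ft_gt (t + r); rewrite ltrDl r0 => /(_ isT).
by rewrite (FD t) ?lerDl ?ltW// Ft; lra.
Qed.

(** Take x - t clipped to [0, 1], with [t] a point splitting [A]: it vanishes to the left of [t],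
    and takes small positive values just to the right, where [A] always has mass. *)
Lemma lebesgue01_theta (A : set TR) : measurable A -> (0 < mu A)%E ->
  exists theta : TR -> R, [/\ measurable_fun setT theta,
    forall x, 0 <= theta x <= 1,
    (0 < mu (A `&` [set x | theta x = 0%R]))%E &
    forall r : R, 0 < r -> (0 < mu (A `&` [set x | (0 < theta x < r)%R]))%E].
Proof.
move=> mA /(lebesgue01_split mA)[t].
pose theta (x : TR) : R := Num.min 1 (Num.max 0 (x - t)).
have theta01 (x : R) : 0 <= theta x <= 1.
  by rewrite /theta;
    case: (leP 0 (x - t)) => ?; [case: (leP 1 (x - t)) => ?|case: (leP (1 : R) 0) => ?];
    try (apply/andP; split); lra.
have theta0 (x : R) : x <= t -> theta x = 0.
  by move=> xt; rewrite /theta;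
    case: (leP 0 (x - t)) => ?; [case: (leP 1 (x - t)) => ?|case: (leP (1 : R) 0) => ?];
    try (apply/andP; split); lra.
have theta_gt0 (s x : R) : s < 1 -> t < x <= t + s -> 0 < theta x <= s.
  by move=> s1 /andP[tx xts]; rewrite /theta;
    case: (leP 0 (x - t)) => ?; [case: (leP 1 (x - t)) => ?|case: (leP (1 : R) 0) => ?];
    try (apply/andP; split); lra.
move=> [t0 tr].
have mtheta : measurable_fun setT theta.
  apply: measurable_minr => //; apply: measurable_maxr => //.
  exact: measurable_funB.
have mpre (B : set R) : measurable B -> measurable (theta @^-1` B).
  by move=> mB; rewrite -[X in measurable X]setTI; exact: mtheta.
exists theta; split => //.
- apply: lt_le_trans t0 _; rewrite le_measure ?inE//.
  + exact: measurableI.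
  + by apply: measurableI => //; exact: (mpre [set 0]).
  + move=> x [Ax /=]; rewrite in_itv/= => xt; split => //=.
    exact: theta0.
(* The bound s < 1 stays below the upper clipping of [theta], and s < r turns theta <= s into a
   strict bound by [r]. *)
- move=> r r0; pose s := Num.min 1 r / 2.
  have s0 : 0 < s by rewrite divr_gt0// lt_min ltr01.
  have [s1 sr] : s < 1 /\ s < r.
    by clear -r0; rewrite /s; case: (leP 1 r) => ?; split; lra.
  apply: lt_le_trans (tr s s0) _; rewrite le_measure ?inE//.
  + exact: measurableI.
  + apply: measurableI => //.
    rewrite (_ : [set x | _] = theta @^-1` `]0, r[%classic); first exact: mpre.
    by apply/seteqP; split=> x /=; rewrite in_itv.
  + move=> x [Ax /=]; rewrite in_itv/= => xt; split => //=.
    have /andP[-> /=] := theta_gt0 s x s1 xt => h; exact: le_lt_trans h sr.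
Qed.

End lebesgue01.

Theorem theorem2p15 (R : realType) (Y : completeNormedModType R)
    (Y_nontrivial : exists y : Y, y != 0)
    (Y_RNP : radon_nikodym_property Y) :
  dense (NA (L1_01 R) Y `\` BSa (L1_01 R) Y).
Proof.
(* [LspaceType1 mu] is convertible with [L1_01 R]; this choice only supplies the finite measure
   structure. *)
pose mu : {finite_measure set measurableTypeR R -> \bar R} :=
  @finite_lebesgue01 R.
suff approx (U : blin (LspaceType1 mu) Y) (e : R) : 0 < e ->
    exists2 V : blin (LspaceType1 mu) Y,
      (NA (LspaceType1 mu) Y `\` BSa (LspaceType1 mu) Y) V & `|U - V| <= 5 * e.
  move=> O [U OU] oO; have : nbhs U O by exact: open_nbhs_nbhs.
  move=> /nbhs_normP[r /= r0 rO].
  (* The perturbation costs 5 e, and 5 r / 6 < r keeps [V] in the open ball. *)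
  have [V Vgood UV] := approx U (r / 6) (divr_gt0 r0 (ltr0n _ 6)).
  exists V; split => //; apply: rO => /=.
  by apply: le_lt_trans UV _; lra.
move=> e0; have mu0 : (0 < mu setT)%E.
  rewrite finite_lebesgue01E setTI lebesgue_measure_itv/= lte_fin ltr01.
  by rewrite oppr0 adde0 lte_fin ltr01.
have [A [y [mA A0 /andP[yge yle] UA]]] := RNP_almost_constant U Y_RNP mu0 e0.
have [theta [mtheta theta01 Z0 tr]] := lebesgue01_theta mA A0.
(* The vector [y] may be zero when the norm of [U] is at most 2e; any unit vector then serves as
   [u], and one exists because [Y] is nontrivial. *)
have [u u1 yu] : exists2 u : Y, `|u| = 1 & y = `|y| *: u.
  have unit (z : Y) : z != 0 -> `| `|z|^-1 *: z| = 1.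
    by move=> z0; rewrite normrZ normfV normr_id mulVf// normr_eq0.
  have [->|y0] := eqVneq y 0.
    have [z z0] := Y_nontrivial.
    by exists (`|z|^-1 *: z); rewrite ?unit// normr0 scale0r.
  by exists (`|y|^-1 *: y); rewrite ?unit// scalerA divff ?scale1r// normr_eq0.
apply: (exists_NA_not_BSa e0 mA u1 _ UA mtheta theta01 Z0 tr).
(* As [y] is |y| u, the distance is |U| + e - |y|, which lies between 0 and 3e by the two bounds on
   |y|. *)
clear -yge yle yu u1; rewrite yu -scalerBl normrZ u1 mulr1 ger0_norm; lra.
Qed.
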